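(* Let $G$ and $H$ be totally disconnected, locally compact groups and let $\phi: G \rightarrow H$ be a continuous homomorphism. Let $K_1$ and $K_2$ be compactly generated subgroups of $G$ such that $K_1 \approx_G K_2$. Then $\phi(K_1) \approx_H \phi(K_2)$. In particular, there is a well-defined map \[ \theta: \mathcal{E}_G \rightarrow \mathcal{E}_H; \quad E_G(O) \mapsto E_H(\phi(O)), \] where $O$ ranges over the compactly generated open subgroups of $G$. If $H = \phi(G)X$ for a compact set $X$, then $\theta$ is surjective.
   Context: All topological groups are Hausdorff. A subgroup is compactly generated if it is generated by a compact subset. For a subgroup $L$ of a totally disconnected, locally compact group $G$, a reduced envelope for $L$ in $G$ is an open subgroup $E$ of $G$ such that $L\le E$ and such that, for any open subgroup $E_2$ of $G$ with $|L:L\cap E_2|$ finite, $|E:E\cap E_2|$ is finite. Reduced envelopes, when they exist, are unique up to commensurability (two subgroups are commensurate if their intersection has finite index in both). If $L$ has a reduced envelope, its envelope class $E_G(L)$ is the set of open subgroups of $G$ commensurate to a reduced envelope for $L$. Subgroups $L_1,L_2\le G$ are envelope equivalent, written $L_1\approx_G L_2$, if both have reduced envelopes in $G$ and $E_G(L_1)=E_G(L_2)$. An open subgroup $O$ of $G$ is its own reduced envelope, so $E_G(O)$ is the commensurability class of $O$ among open subgroups of $G$. $\mathcal{E}_G$ denotes the set of commensurability classes (among open subgroups of $G$) of compactly generated open subgroups of $G$; $\mathcal{E}_H$ is defined likewise for $H$. *)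

(* Defs.v *)
From HB Require Import structures.
From mathcomp Require Import all_boot all_order.
From mathcomp Require Import all_classical.
From mathcomp Require Import topology.

Set Implicit Arguments.
Unset Strict Implicit.
Unset Printing Implicit Defensive.

Local Open Scope classical_set_scope.
Local Open Scope group_scope.

HB.mixin Record Group_isTopologicalGroup G of Topological G & Group G := {
  mulg_continuous : continuous (fun x : (G * G)%type => x.1 * x.2 : G) ;
  invg_continuous : continuous (fun x : G => x^-1)
}.

#[short(type="topologicalGroupType")]
HB.structure Definition TopologicalGroup :=
  {G of Topological G & Group G & Group_isTopologicalGroup G}.

Section TopologicalGroupDefs.
Variable G : topologicalGroupType.
Implicit Types A B C E L O : set G.

(* topologicalGroupType carries no separation axiom, so Hausdorff is required
   here. *)
Definition tdlc_group : Prop :=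
  [/\ hausdorff_space G, totally_disconnected [set: G]
    & locally_compact [set: G]].

Definition subgroup A : Prop := group_closed (mem A).

Definition open_subgroup A : Prop := subgroup A /\ open A.

Definition compactly_generated A : Prop :=
  exists2 C, compact C & A = smallest subgroup C.

Definition left_cosets A B : set (set G) :=
  [set [set a * b | b in B] | a in A].

(* |A : B| is finite; meant for subgroups B of A. *)
Definition finite_index A B : Prop := finite_set (left_cosets A B).

Definition commensurate A B : Prop :=
  finite_index A (A `&` B) /\ finite_index B (A `&` B).

Definition reduced_envelope L E : Prop :=
  [/\ open_subgroup E, L `<=` E
    & forall E2, open_subgroup E2 ->
        finite_index L (L `&` E2) -> finite_index E (E `&` E2)].

Definition has_reduced_envelope L : Prop := exists E, reduced_envelope L E.

(* E_G(L); empty when L has no reduced envelope. *)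
Definition envelope_class L : set (set G) :=
  [set E | open_subgroup E /\
           exists2 R, reduced_envelope L R & commensurate E R].

Definition envelope_equivalent L1 L2 : Prop :=
  [/\ has_reduced_envelope L1, has_reduced_envelope L2
    & envelope_class L1 = envelope_class L2].

Definition commensurability_class O : set (set G) :=
  [set E | open_subgroup E /\ commensurate E O].

(* The set written as a calligraphic E_G. *)
Definition cg_open_classes : set (set (set G)) :=
  [set commensurability_class O |
    O in [set O | open_subgroup O /\ compactly_generated O]].

End TopologicalGroupDefs.

Arguments tdlc_group : clear implicits.
Arguments cg_open_classes : clear implicits.

Section EnvelopeClassOpen.
Variable G : topologicalGroupType.
Implicit Types A B C E L O : set G.

Lemma subgroupP A : subgroup A <->
  A 1 /\ (forall x y, A x -> A y -> A (x / y)).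
Proof.
split=> [[A1 AF]|[A1 AF]].
  split; first by move: A1; rewrite inE.
  by move=> x y Ax Ay; move: (AF x y); rewrite !inE; apply.
split; first by rewrite inE.
by move=> x y; rewrite !inE; exact: AF.
Qed.

Lemma subgroup1 A : subgroup A -> A 1.
Proof. by move/subgroupP=> []. Qed.

Lemma subgroupV A x : subgroup A -> A x -> A x^-1.
Proof. by move/subgroupP=> [A1 AF] Ax; rewrite -[x^-1]mul1g; exact: AF. Qed.

Lemma subgroupM A x y : subgroup A -> A x -> A y -> A (x * y).
Proof.
move=> sA Ax Ay; have /subgroupP[_ AF] := sA.
by rewrite -[y]invgK; apply: AF => //; exact: subgroupV.
Qed.

Lemma subgroupI A B : subgroup A -> subgroup B -> subgroup (A `&` B).
Proof.
move=> /subgroupP[A1 AF] /subgroupP[B1 BF]; apply/subgroupP; split=> //.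
by move=> x y [Ax Bx] [Ay By]; split; [exact: AF|exact: BF].
Qed.

Lemma finite_indexP A B : subgroup B ->
  finite_index A B <->
  exists F, [/\ finite_set F, F `<=` A
    & forall a, A a -> exists2 f, F f & B (f^-1 * a)].
Proof.
move=> sB; split=> [fAB|[F [fF FA AF]]].
  have ex c : exists x, left_cosets A B c -> A x /\ c = [set x * b | b in B].
    have [[x Ax <-]|nc] := pselect (left_cosets A B c); first by exists x.
    by exists 1.
  have [r rP] := choice ex.
  exists (r @` left_cosets A B); split.
  - exact: finite_image.
  - by move=> _ [c /rP[+ _] <-].
  move=> a Aa; pose c := [set a * b | b in B].
  have cP : left_cosets A B c by exists a.
  have ca : c a by exists 1; [exact: subgroup1|rewrite mulg1].
  clearbody c; exists (r c); first by exists c.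
  have [_ cE] := rP _ cP.
  by move: ca; rewrite [in X in X -> _]cE => -[b Bb <-]; rewrite mulKg.
apply: (@sub_finite_set _ _ ((fun f => [set f * b | b in B]) @` F)); last first.
  exact: finite_image.
move=> _ [a Aa <-]; have [f Ff Bfa] := AF _ Aa; exists f => //.
apply/seteqP; split=> x [b Bb <-].
  exists ((f^-1 * a)^-1 * b).
    by apply: subgroupM => //; exact: subgroupV.
  by rewrite invgM invgK -!mulgA mulVKg.
exists (f^-1 * a * b); first exact: subgroupM.
by rewrite !mulgA mulgV mul1g.
Qed.

Lemma finite_index_refl A : subgroup A -> finite_index A A.
Proof.
move=> sA; apply/finite_indexP => //; exists [set 1]; split.
- exact: finite_set1.
- by move=> _ ->; exact: subgroup1.
- by move=> a Aa; exists 1 => //; rewrite invg1 mul1g.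
Qed.

Lemma finite_index_trans A B C : subgroup A -> subgroup B -> subgroup C ->
  B `<=` A -> finite_index A B -> finite_index B C -> finite_index A C.
Proof.
move=> sA sB sC BA /(finite_indexP _ sB)[F [fF FA AF]].
move=> /(finite_indexP _ sC)[K [fK KB BK]]; apply/finite_indexP => //.
exists [set f * k | f in F & k in K]; split.
- exact: finite_image2.
- move=> _ [f Ff [k Kk <-]]; apply: subgroupM => //; first exact: FA.
  exact/BA/KB.
move=> a /AF[f Ff /BK[k Kk Ck]]; exists (f * k).
  by exists f => //; exists k.
by rewrite invgM -mulgA.
Qed.

Lemma finite_index_sub A B C : subgroup B -> subgroup C -> C `<=` A ->
  finite_index A B -> finite_index C (C `&` B).
Proof.
move=> sB sC CA /(finite_indexP _ sB)[F [fF FA AF]].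
apply/finite_indexP; first exact: subgroupI.
have ex f : exists x, C x /\ forall y, C y -> B (f^-1 * y) -> B (f^-1 * x).
  have [[x Cx Bx]|nx] := pselect (exists2 x, C x & B (f^-1 * x)).
    by exists x.
  exists 1; split; first exact: subgroup1.
  by move=> y Cy By; exfalso; apply: nx; exists y.
have [r rP] := choice ex.
exists (r @` F); split.
- exact: finite_image.
- by move=> _ [f _ <-]; have [] := rP f.
move=> c Cc; have [f Ff Bfc] := AF _ (CA _ Cc).
have [Cr Br] := rP f.
exists (r f); first by exists f.
split; first by apply: subgroupM => //; exact: subgroupV.
have -> : (r f)^-1 * c = (f^-1 * r f)^-1 * (f^-1 * c).
  by rewrite invgM invgK -!mulgA mulVKg.
by apply: subgroupM => //; apply: subgroupV => //; exact: Br Cc Bfc.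
Qed.

Lemma open_subgroup_reduced_envelope O :
  open_subgroup O -> reduced_envelope O O.
Proof. by move=> oO; split. Qed.

Lemma envelope_class_open O :
  open_subgroup O -> envelope_class O = commensurability_class O.
Proof.
move=> oO; apply/seteqP; split=> E /=; last first.
  by move=> [oE EO]; split=> //; exists O => //;
    exact: open_subgroup_reduced_envelope.
move=> [oE [R [oR OR Rmin] [fER fRE]]]; split=> //.
have [sE _] := oE; have [sR _] := oR; have [sO _] := oO.
have fRO : finite_index R O.
  rewrite -(setIidr OR); apply: Rmin => //.
  by rewrite setIid; exact: finite_index_refl.
have sER := subgroupI sE sR.
split; last first.
  have -> : E `&` O = O `&` (E `&` R).
    by rewrite setIC setICA setIC [O `&` R]setIidl // setIC.
  exact: finite_index_sub fRE.
apply: (finite_index_trans sE sER) (@subIsetl _ _ _) fER _.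
  exact: subgroupI.
have -> : E `&` O = E `&` R `&` O by rewrite -setIA (setIidr OR).
by apply: finite_index_sub fRO => //; exact: subIsetr.
Qed.

End EnvelopeClassOpen.

(* Main.v *)
(** An open subgroup E containing K is a reduced envelope as soon as every open
    subgroup containing all of K meets E in finite index: if E2 contains only a
    finite-index subgroup of K, the intersection N of its finitely many
    K-conjugates is open and K N is an open subgroup containing K, in which E2
    has finite index.  For K generated by a compact set C, such an E is
    <C, U ∩ E0>, where U is a compact open subgroup and E0 is an open subgroup
    containing K chosen so that (U ∩ E0) C meets as few cosets of U as possible.

    If K1 and K2 are envelope equivalent and F1 is a reduced envelope of phi K1,
    then phi^-1 F1 is open and contains K1, hence meets the common envelope, and
    so K2, in finite index; thus F1 contains a finite-index subgroup of phi K2.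

    For surjectivity, cocompactness of phi G gives an open compactly generated
    O' <= H a finitely generated subgroup L of O' ∩ phi G with O' = V L, V
    compact.  Then O' is a reduced envelope of L, hence of phi O whenever
    L <= phi O <= O'. *)
Require Import Defs.
From mathcomp Require Import all_boot all_order finmap.
From mathcomp Require Import all_classical.
From mathcomp Require Import topology.

Set Implicit Arguments.
Unset Strict Implicit.
Unset Printing Implicit Defensive.

Local Open Scope classical_set_scope.
Local Open Scope group_scope.

(** * Separation and compact open neighbourhoods *)

(** A point outside the closure of V has a neighbourhood outside the closures of V and of all its
    subsets; near-covering compactness then supplies a single V for all of [K]. *)
Lemma compact_closure_disjoint {T : topologicalType} (F : set_system T)
    (FF : ProperFilter F) (K : set T) : compact K ->
  (forall x, K x -> exists2 V, F V & ~ closure V x) ->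
  exists2 V, F V & K `&` closure V = set0.
Proof.
move=> /compact_near_coveringP cK KF.
have /near_powerset_filter_fromP : \forall V \near powerset_filter_from F,
    K `<=` (fun x => ~ closure V x).
  apply: cK => x /KF[V FV nVx].
  exists (~` closure V, [set W | W `<=` V]); first split => /=.
  - by apply: open_nbhs_nbhs; split => //; exact/closed_openC/closed_closure.
  - exact: small_set_sub.
  by move=> [y W] /= [nVy /closureS WV] /WV.
case=> [A B AB KB x Kx /(closureS AB)|V FV KV]; first exact: KB.
exists V => //; apply/disjoints_subset; exact: KV.
Qed.

(** The preceding lemma is used twice: with the neighbourhoods of a point of [B] against [A], then
    with the neighbourhoods of [A] against [B]. The second filter is proper because [A] is
    nonempty. *)
Lemma compact_separation {T : topologicalType} (A B : set T) :
  hausdorff_space T -> A !=set0 -> compact A -> compact B -> A `&` B = set0 ->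
  exists U V, [/\ open U, open V, A `<=` U, B `<=` V & U `&` V = set0].
Proof.
move=> hT A0 cA cB AB0.
have pA : ProperFilter (set_nbhs A).
  split; last exact: set_nbhs_filter.
  by move=> h; have [a Aa] := A0; have /nbhs_singleton := h a Aa.
have [V AV VB] : exists2 V, set_nbhs A V & B `&` closure V = set0.
  apply: compact_closure_disjoint => // b Bb.
  have [V bV VA] : exists2 V, nbhs b V & A `&` closure V = set0.
    apply: compact_closure_disjoint => // a Aa.
    apply: contrapT => /forall2NP nV.
    suff ba : b = a.
      by rewrite ba in Bb; have : (A `&` B) a by []; rewrite AB0.
    apply: hT => U W bU aW; have [|/contrapT cU] := nV U; first by [].
    exact: cU.
  exists (~` closure V).
    move=> a Aa; apply: open_nbhs_nbhs; split.
      exact/closed_openC/closed_closure.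
    by move: VA => /disjoints_subset VA; exact: VA.
  move=> /(_ V bV)[x [nVx Vx]]; apply: nVx; exact: subset_closure.
have /set_nbhsP[U [oU AU UV]] := AV.
exists U, (~` closure V); split=> //.
- exact/closed_openC/closed_closure.
- exact/disjoints_subset.
- apply/disjoints_subset; rewrite setCK.
  exact: subset_trans UV (@subset_closure _ _).
Qed.

(* The intersection Q of the relatively clopen subsets of K containing x is
   connected: disjoint open sets splitting Q would split one of them too.  Hence
   Q = {x}, and by compactness one of those subsets lies in the interior of K. *)
Lemma totally_disconnected_compact_open {T : topologicalType}
    (K : set T) (x : T) : hausdorff_space T -> totally_disconnected [set: T] ->
  compact K -> nbhs x K ->
  exists W, [/\ open W, compact W, W x & W `<=` K].
Proof.
move=> hT tdT cK nK.
have clK : closed K := compact_closed hT cK.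
(* As [K] is closed, being clopen relative to [K] amounts to closedness in [T] of [D] and of [K]
   minus [D]. *)
pose DD := [set D : set T | [/\ D x, D `<=` K, closed D & closed (K `\` D)]].
have DDK : DD K by split=> //;
  [exact: nbhs_singleton|rewrite setDv; exact: closed0].
have DDI A B : DD A -> DD B -> DD (A `&` B).
  move=> [Ax AK cA cKA] [Bx BK cB cKB]; split=> //.
  - by move=> y [/AK].
  - exact: closedI.
  - by rewrite setDIr; exact: closedU.
pose F := filter_from DD id.
have FF : Filter F.
  apply: filter_from_filter; first by exists K.
  by move=> A B dA dB; exists (A `&` B) => //; exact: DDI.
have PF : ProperFilter F by apply: filter_from_proper => D [Dx _ _ _]; exists x.
pose Q := \bigcap_(D in DD) D.
have Qx : Q x by move=> D [].
have QK : Q `<=` K by move=> y; exact.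
have clQ : closed Q by apply: closed_bigI => D [].
have QO O : open O -> Q `<=` O -> exists2 D, DD D & D `<=` O.
  move=> oO qO.
  have [|y [Ky nOy]|V [D dD DV]] :=
    @compact_closure_disjoint _ F PF (K `&` ~` O).
  - by apply: compact_closedI => //; exact: open_closedC.
  - apply: contrapT => /forall2NP h; apply: nOy; apply: qO => D dD.
    have [nFD|/contrapT] := h D; first by exfalso; apply: nFD; exists D.
    by have [_ _ /closure_id <- _] := dD.
  move=> /disjoints_subset KOV; exists D => // y Dy; apply: contrapT => nOy.
  apply: (KOV y); last by apply: subset_closure; exact: DV.
  by split=> //; have [_ DK _ _] := dD; exact: DK.
have QE : Q `<=` [set x].
  rewrite -(tdT x I).
  apply: connected_component_max => //.
  apply/connectedP => E [E0 QU [s1 s2]].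
  have clE b : closed (E b).
    move=> y cy; have : Q y.
      apply: clQ; apply: closureS cy; rewrite QU.
      by case: b => z ?; [right|left].
    rewrite QU; case: b cy => cy [] // Ey.
      have : (E false `&` closure (E true)) y by [].
      by rewrite s2.
    have : (closure (E false) `&` E true) y by [].
    by rewrite s1.
  have cE b : compact (E b).
    apply: (subclosed_compact (clE b) cK) => y Ey; apply: QK; rewrite QU.
    by case: b Ey; [right|left].
  have disj : E false `&` E true = set0.
    by rewrite {1}(iffLR (closure_id _) (clE false)).
  have [U [V [oU oV EU EV UV0]]] :=
    compact_separation hT (E0 false) (cE false) (cE true) disj.
  have [| |D [Dx DK cD cKD] DUV] := QO (U `|` V); first exact: openU.
    by rewrite QU; exact: setUSS.
  have UV y : U y -> V y -> False.
    by move=> Uy Vy; have : (U `&` V) y by []; rewrite UV0.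
  have part A B : open A -> open B -> (forall y, A y -> B y -> False) ->
      D `<=` A `|` B -> A x -> DD (D `&` A).
    move=> oA oB AB0 DAB Ax; split=> //.
    - by move=> y [/DK].
    - have -> : D `&` A = D `\` B.
        apply/seteqP; split=> y [Dy yA]; split=> //; first by move/AB0: yA.
        by case: (DAB _ Dy).
      by rewrite setDE; apply: closedI => //; exact: open_closedC.
    - rewrite setDIr; apply: closedU => //.
      by rewrite setDE; apply: closedI => //; exact: open_closedC.
  (* The piece containing x yields a member of [DD], which contains [Q] yet misses the other,
     nonempty piece. *)
  have : Q x by []; rewrite QU => -[Ex|Ex].
    have dU := part _ _ oU oV UV DUV (EU _ Ex).
    have [y Ey] := E0 true; apply: (UV y); last exact: EV.
    by have /(_ _ dU)[] : Q y by rewrite QU; right.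
  have dV : DD (D `&` V).
    apply: (part _ U) => //; [by move=> y Vy Uy; exact: UV Uy Vy| |exact: EV].
    by rewrite setUC.
  have [y Ey] := E0 false; apply: (UV y); first exact: EU.
  by have /(_ _ dV)[] : Q y by rewrite QU; left.
have [| |D [Dx DK cD cKD] DO] := QO K°; first exact: open_interior.
  by move=> y /QE ->; exact: nbhs_singleton (nbhs_interior nK).
exists D; split=> //; last exact: subclosed_compact cK DK.
have -> : D = K° `&` ~` (K `\` D).
  apply/seteqP; split=> y; first by move=> Dy; split; [exact: DO|case].
  by move=> [/interior_subset Ky /not_andP[//|/contrapT]].
by apply: openI; [exact: open_interior|exact: closed_openC].
Qed.

(** * Translations, generated subgroups and open subgroups *)

Section TopologicalGroup.
Variable G : topologicalGroupType.
Implicit Types A B C D E K L O U : set G.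

Lemma mulgl_continuous (a : G) : continuous (fun x => a * x).
Proof.
move=> x; apply: (@cvg_comp _ _ _ (fun y => (a, y)) (fun z => z.1 * z.2)
  (nbhs x) (nbhs (a, x))); last exact: (@mulg_continuous G (a, x)).
by apply: cvg_pair; [exact: cvg_cst|exact: cvg_id].
Qed.

Lemma mulgr_continuous (a : G) : continuous (fun x => x * a).
Proof.
move=> x; apply: (@cvg_comp _ _ _ (fun y => (y, a)) (fun z => z.1 * z.2)
  (nbhs x) (nbhs (x, a))); last exact: (@mulg_continuous G (x, a)).
by apply: cvg_pair; [exact: cvg_id|exact: cvg_cst].
Qed.

Lemma near_mulVg (a : G) A : nbhs 1 A -> \forall x \near a, A (a^-1 * x).
Proof. by move=> nA; apply: (@mulgl_continuous a^-1 a A); rewrite mulVg. Qed.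

Lemma compact_mulg A B : compact A -> compact B ->
  compact [set a * b | a in A & b in B].
Proof.
move=> cA cB.
have -> : [set a * b | a in A & b in B] = (fun x => x.1 * x.2) @` (A `*` B).
  by rewrite image2E; apply: eq_imagel => -[].
apply: continuous_compact (compact_setX cA cB).
by apply: continuous_subspaceT; exact: mulg_continuous.
Qed.

Lemma compact_invg A : compact A -> compact [set a^-1 | a in A].
Proof.
move=> cA; apply: continuous_compact cA.
by apply: continuous_subspaceT; exact: invg_continuous.
Qed.

Lemma subgroup_smallest D : subgroup (smallest (@subgroup G) D).
Proof.
apply/subgroupP; split=> [A [sA _]|x y Dx Dy A [sA DA]]; first exact: subgroup1.
have /subgroupP[_] := sA; apply; [exact: Dx|exact: Dy].
Qed.

(** Elements whose left translation preserves [P] in both directions form a subgroup: the two-way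
    condition handles inverses, and symmetry of [D] puts [D] inside it. *)
Lemma smallest_subgroup_ind D (P : set G) : (forall d, D d -> D d^-1) -> P 1 ->
  (forall d x, D d -> P x -> P (d * x)) -> smallest (@subgroup G) D `<=` P.
Proof.
move=> DV P1 PD x.
suff /(_ x) PS :
    smallest (@subgroup G) D `<=` [set g | forall y, P y <-> P (g * y)].
  by move/PS => /= /(_ 1); rewrite mulg1 => -[+ _]; exact.
apply: smallest_sub => //.
  apply/subgroupP; split=> /= [y|g h Pg Ph y]; first by rewrite mul1g.
  by rewrite -mulgA -Pg (Ph (h^-1 * y)) mulVKg.
move=> d Dd y; split=> [|Pdy]; first exact: PD.
by rewrite -[y](mulKg d); apply: PD => //; exact: DV.
Qed.

Lemma compactly_generated_subgroup K : compactly_generated K -> subgroup K.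
Proof. by move=> [C _ ->]; exact: subgroup_smallest. Qed.

Lemma compactly_generated_sym K : compactly_generated K ->
  exists C, [/\ compact C, (forall c, C c -> C c^-1)
    & K = smallest (@subgroup G) C].
Proof.
move=> [C cC ->]; exists (C `|` [set c^-1 | c in C]); split.
- by apply: compactU => //; exact: compact_invg.
- by move=> c [Cc|[d Cd <-]]; [right; exists c|left; rewrite invgK].
apply/seteqP; split.
  apply: smallest_sub; first exact: subgroup_smallest.
  by apply: sub_smallest; left.
apply: smallest_sub; first exact: subgroup_smallest.
move=> c [Cc|[d Cd <-]]; first exact: sub_gen_smallest.
have : smallest (@subgroup G) C d by exact: sub_gen_smallest.
exact: (subgroupV (subgroup_smallest C)).
Qed.

Lemma nbhs1_open_subgroup A : subgroup A -> nbhs 1 A -> open_subgroup A.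
Proof.
move=> sA nA; split=> //; rewrite openE => a Aa.
apply: filterS (near_mulVg a nA) => x /= Ax; rewrite -[x](mulVKg a).
exact: subgroupM.
Qed.

Lemma open_subgroup_nbhs1 A : open_subgroup A -> nbhs 1 A.
Proof.
by move=> [sA oA]; apply: open_nbhs_nbhs; split=> //; exact: subgroup1.
Qed.

Lemma open_subgroupS A B : open_subgroup A -> subgroup B -> A `<=` B ->
  open_subgroup B.
Proof.
move=> oA sB AB; apply: nbhs1_open_subgroup => //.
exact: filterS AB (open_subgroup_nbhs1 oA).
Qed.

Lemma open_subgroupI A B : open_subgroup A -> open_subgroup B ->
  open_subgroup (A `&` B).
Proof.
by move=> [sA oA] [sB oB]; split; [exact: subgroupI|exact: openI].
Qed.

Lemma open_subgroup_closed A : open_subgroup A -> closed A.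
Proof.
move=> oA x clx; have [sA _] := oA.
have /clx := near_mulVg x (open_subgroup_nbhs1 oA).
move=> [y [Ay /= Axy]]; rewrite -[x]invgK; apply: subgroupV => //.
by rewrite -[x^-1](mulgK y); apply: subgroupM => //; exact: subgroupV.
Qed.

Lemma compact_finite_cosets K U : compact K -> open_subgroup U ->
  exists F, [/\ finite_set F, F `<=` K
    & forall x, K x -> exists2 f, F f & U (f^-1 * x)].
Proof.
move=> /compact_near_coveringP cK oU; have [sU _] := oU.
pose up (S : set G) := [set S' | S `<=` S'].
(* Compactness is run along the finite subsets of [K] directed by inclusion; near x, the single
   representative x suffices. *)
pose FF := filter_from [set S | finite_set S /\ S `<=` K] up.
have fFF : Filter FF.
  apply: filter_from_filter.
    by exists set0; split; [exact: finite_set0|exact: sub0set].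
  move=> A B [fA AK] [fB BK]; exists (A `|` B).
    by split; [rewrite finite_setU|rewrite subUset].
  by move=> S; rewrite /up /= subUset.
have [S [fS SK] SP] : \forall S \near FF,
    K `<=` [set x | exists2 f, S f & U (f^-1 * x)].
  apply: cK => x Kx.
  exists ((fun y => x^-1 * y) @^-1` U, up [set x]); first split => /=.
  - exact: near_mulVg (open_subgroup_nbhs1 oU).
  - by exists [set x] => //; split; [exact: finite_set1|move=> _ ->].
  by move=> [y S] /= [Uy Sx]; exists x => //; exact: Sx.
by exists S; split=> //; exact: SP.
Qed.

(** [V] is the right stabiliser of a compact open neighbourhood [W] of 1 inside [O]. It lies in [W]
    because 1 does, and it is open because, by compactness of [W], all v near 1 and their inverses
    translate [W] into itself. *)
Lemma van_dantzig O : tdlc_group G -> open_subgroup O ->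
  exists U, [/\ open_subgroup U, compact U & U `<=` O].
Proof.
move=> [hG tdG lcG] oO.
have [B nB [cB _]] := lcG 1 I.
have {}nB : nbhs (1 : G) B 
  by move: nB; rewrite /within /=; apply: filterS => x; exact.
have [||W [oW cW W1 WBO]] :=
  @totally_disconnected_compact_open _ (B `&` O) 1 hG tdG.
- by apply: compact_closedI => //; exact: open_subgroup_closed.
- by apply: filterI => //; exact: open_subgroup_nbhs1.
pose V := [set v | forall w, W w <-> W (w * v)].
have sV : subgroup V.
  apply/subgroupP; split=> /= [w|g h Vg Vh w]; first by rewrite mulg1.
  by rewrite (Vg w) (Vh (w * (g / h))) mulgA mulgVK.
have VW : V `<=` W by move=> v Vv; have := Vv 1; rewrite mul1g => -[]; auto.
have oV : open_subgroup V.
  apply: nbhs1_open_subgroup => //.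
  have Wmul : \forall v \near (1 : G), W `<=` [set w | W (w * v)].
    apply: (iffLR (compact_near_coveringP W) cW) => w Ww.
    have := @mulg_continuous G (w, 1) W; rewrite /= mulg1.
    by move=> /(_ (open_nbhs_nbhs (conj oW Ww))).
  have Winv : \forall v \near (1 : G), W `<=` [set w | W (w * v^-1)].
    have invg_cvg1 : v^-1 @[v --> (1 : G)] --> (1 : G).
      by rewrite -{2}[1]invg1; exact: invg_continuous.
    exact: invg_cvg1 Wmul.
  apply: filterS2 Wmul Winv => v Wv WVv w; split=> [/Wv //|/WVv].
  by rewrite /= mulgK.
exists V; split=> //; last by move=> v /VW/WBO[].
by apply: subclosed_compact cW VW; exact: open_subgroup_closed.
Qed.

Lemma near1_conjg (a : G) A : nbhs 1 A -> \forall x \near (1 : G), A (x ^ a).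
Proof.
move=> nA.
apply: (@mulgr_continuous a 1 [set y | A (a^-1 * y)]); rewrite /= mul1g.
exact: near_mulVg.
Qed.

(** * Finite index and existence of reduced envelopes *)

Lemma finite_indexSr A B C : subgroup B -> subgroup C -> B `<=` C ->
  finite_index A B -> finite_index A C.
Proof.
move=> sB sC BC /(finite_indexP _ sB)[F [fF FA AF]]; apply/finite_indexP => //.
by exists F; split=> // a /AF[f Ff /BC Cfa]; exists f.
Qed.

Lemma finite_index_compact A B K : compact K -> K `<=` A -> open_subgroup B ->
  (forall a, A a -> exists2 k, K k & B (k^-1 * a)) -> finite_index A B.
Proof.
move=> cK KA oB AKB; have [sB _] := oB.
have [F [fF FK KF]] := compact_finite_cosets cK oB.
apply/finite_indexP => //; exists F; split=> // [|a /AKB[k /KF[f Ff Bfk] Bka]].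
  exact: subset_trans FK KA.
exists f => //; have -> : f^-1 * a = (f^-1 * k) * (k^-1 * a).
  by rewrite -mulgA mulVKg.
exact: subgroupM.
Qed.

Lemma finite_index_setI K E A : subgroup K -> subgroup E -> subgroup A ->
  K `<=` E -> finite_index E (E `&` A) -> finite_index K (K `&` A).
Proof.
move=> sK sE sA KE fE; have sEA := subgroupI sE sA.
apply: (@finite_indexSr _ (K `&` (E `&` A))).
- exact: subgroupI.
- exact: subgroupI.
- by move=> x [Kx [_ Ax]].
- exact: (finite_index_sub sEA sK KE fE).
Qed.

(* If K meets E2 in finite index, N is the intersection of the finitely many
   K-conjugates of E2: it is open and normalised by K, so that K N is an open
   overgroup of K in which E2 has finite index. *)
Lemma reduced_envelope_min K E : subgroup K -> open_subgroup E -> K `<=` E ->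
  (forall E2, open_subgroup E2 -> K `<=` E2 -> finite_index E (E `&` E2)) ->
  reduced_envelope K E.
Proof.
move=> sK oE KE minE; split=> // E2 oE2; have [sE2 _] := oE2.
have [sE _] := oE.
move=> /(finite_indexP _ (subgroupI sK sE2))[F [fF FK KF]].
pose N := [set x | forall k, K k -> E2 (x ^ k)].
have sN : subgroup N.
  apply/subgroupP; split=> /= [k Kk|x y Nx Ny k Kk].
    by rewrite conj1g; exact: subgroup1.
  rewrite conjMg conjVg; apply: subgroupM => //; first exact: Nx.
  by apply: subgroupV => //; exact: Ny.
have NJ x k : K k -> N x -> N (x ^ k).
  by move=> Kk Nx h Kh; rewrite -conjgM; apply: Nx; exact: subgroupM.
have NE2 : N `<=` E2 by move=> x /(_ 1 (subgroup1 sK)); rewrite conjg1.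
have oN : open_subgroup N.
  apply: nbhs1_open_subgroup => //.
  have /finite_fsetP[X FX] := fF.
  have : nbhs (1 : G) (\bigcap_(f in [set` X]) [set x | E2 (x ^ f)]).
    apply: filter_bigI => f _.
    exact: near1_conjg (open_subgroup_nbhs1 oE2).
  (* Write k as f l with f in [F] and l in [E2]: conjugation by l preserves [E2], so the finitely
     many conditions at f suffice. *)
  rewrite -FX; apply: filterS => x Fx k /KF[f Ff [_ E2l]].
  have -> : k = f * (f^-1 * k) by rewrite mulVKg.
  rewrite conjgM [X in E2 X]conjgE; apply: subgroupM => //.
    exact: subgroupV.
  by apply: subgroupM => //; exact: Fx.
pose KN := [set x | exists2 k, K k & N (k^-1 * x)].
have sKN : subgroup KN.
  apply/subgroupP; split=> [|x y [k Kk Nkx] [h Kh Nhy]].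
    by exists 1; [exact: subgroup1|rewrite mulg1 invg1; exact: subgroup1].
  exists (k / h); first by apply: subgroupM => //; exact: subgroupV.
  have -> : (k / h)^-1 * (x / y) = ((k^-1 * x) / (h^-1 * y)) ^ h^-1.
    by rewrite conjgE !invgM !invgK !mulgA mulgK.
  apply: NJ; first exact: subgroupV.
  exact: (subgroupM sN Nkx (subgroupV sN Nhy)).
have KKN : K `<=` KN.
  by move=> k Kk; exists k => //; rewrite mulVg; exact: subgroup1.
have NKN : N `<=` KN.
  by move=> x Nx; exists 1; [exact: subgroup1|rewrite invg1 mul1g].
have oKN : open_subgroup KN := open_subgroupS oN sKN NKN.
have fKN : finite_index KN (KN `&` E2).
  apply/finite_indexP; first exact: subgroupI.
  exists F; split=> //; first exact: subset_trans FK KKN.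
  move=> x KNx; have [k Kk Nkx] := KNx; have [f Ff [_ E2fk]] := KF _ Kk.
  exists f => //; split.
    by apply: (subgroupM sKN _ KNx); apply: (subgroupV sKN); exact/KKN/FK.
  have -> : f^-1 * x = (f^-1 * k) * (k^-1 * x) by rewrite -mulgA mulVKg.
  by apply: subgroupM => //; exact: NE2.
have sEKN := subgroupI sE sKN.
apply: (@finite_indexSr _ (E `&` KN `&` E2)).
- exact: subgroupI.
- exact: subgroupI.
- by move=> x [[Ex _] E2x].
apply: (@finite_index_trans _ _ (E `&` KN)) => //.
- exact: subgroupI.
- exact: minE.
- exact: (@finite_index_setI _ KN).
Qed.

(** The least cardinality is attained, and a subset of a finite set with at least as many elements
    is the whole set. *)
Lemma finite_set_min_ex (T : choiceType) (I : Type) (F : set T) (S : I -> set T)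
    (P : set I) : finite_set F -> (forall i, S i `<=` F) -> P !=set0 ->
  exists2 i, P i & forall j, P j -> S j `<=` S i -> S i `<=` S j.
Proof.
move=> fF SF [i0 Pi0].
have fS i : finite_set (S i) := sub_finite_set (@SF i) fF.
pose m i := size (fset_set (S i)).
have exm : exists n, `[< exists2 i, P i & m i = n >].
  by exists (m i0); apply/asboolP; exists i0.
have [n /asboolP[i Pi <-] nmin] := ex_minnP exm.
exists i => // j Pj Sji.
have := nmin (m j); rewrite asboolT; last by exists j.
move=> /(_ isT) mij.
suff /fset_set_inj -> : fset_set (S j) = fset_set (S i) by [].
by apply/eqP; rewrite eqEfcard; apply/andP; split => //; rewrite -fset_set_sub.
Qed.

(* Among the open subgroups A containing K, choose E0 for which U ∩ E0 moves C
   into the fewest left cosets of U, and let E be generated by C and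
   V = U ∩ E0.  If E' ≤ E is open and contains K, minimality gives
   V C V = (U ∩ E') C V, so that E = E' V by induction on words in C and V, and
   V is compact. *)
Lemma reduced_envelope_ex K : tdlc_group G -> compactly_generated K ->
  exists E, reduced_envelope K E /\ compactly_generated E.
Proof.
move=> tG /compactly_generated_sym[C [cC CV ->]]; set K' := smallest _ _.
have oT : open_subgroup [set: G].
  by split; [apply/subgroupP|exact: openT].
have [U [oU cU _]] := van_dantzig tG oT.
have [sU _] := oU.
have [F [fF _ UCF]] := compact_finite_cosets (compact_mulg cU cC) oU.
(* [S A] records which cosets f U, with f in [F], meet (U ∩ A) C; it is monotone in A. *)
pose S A := F `&` [set f | exists v c, [/\ U v, A v, C c & U (f^-1 * (v * c))]].
have [||E0 [oE0 KE0] minE0] := @finite_set_min_ex _ (set G) F S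
    [set A | open_subgroup A /\ K' `<=` A] fF.
- by move=> A; exact: subIsetl.
- by exists [set: G].
pose V := U `&` E0; pose E := smallest (@subgroup G) (C `|` V).
have sE : subgroup E := subgroup_smallest _.
have [sE0 _] := oE0.
have oV : open_subgroup V by exact: open_subgroupI.
have [sV _] := oV.
have CE : C `<=` E by apply: sub_smallest; left.
have VE : V `<=` E by apply: sub_smallest; right.
have oE : open_subgroup E := open_subgroupS oV sE VE.
have KE : K' `<=` E by apply: smallest_sub.
have EE0 : E `<=` E0.
  apply: smallest_sub => //; rewrite subUset; split=> [|x []//].
  by apply: subset_trans KE0; exact: sub_gen_smallest.
have cV : compact V.
  by apply: compact_closedI => //; exact: open_subgroup_closed.
exists E; split; last by exists (C `|` V) => //; exact: compactU.
apply: reduced_envelope_min => //; first exact: subgroup_smallest.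
move=> E2 oE2 KE2; pose E' := E `&` E2.
have oE' : open_subgroup E' := open_subgroupI oE oE2.
have [sE' _] := oE'.
have KE' : K' `<=` E' by move=> x Kx; split; [exact: KE|exact: KE2].
have CE' : C `<=` E' by apply: subset_trans KE'; exact: sub_gen_smallest.
have SE0 : S E0 `<=` S E'.
  apply: minE0 => // f [Ff [v [c [Uv [Ev _] Cc Ufvc]]]]; split=> //.
  by exists v, c; split=> //; exact: EE0.
have VCV v c : V v -> C c -> exists2 u, V u & E' (v * c * u).
  move=> Vv Cc; have [Uv E0v] := Vv.
  have [|f Ff Uf] := UCF (v * c); first by exists v => //; exists c.
  have [|_ [v' [c' [Uv' E'v' Cc' Uf']]]] := SE0 f.
    by split=> //; exists v, c.
  have E'vc : E' (v' * c') := subgroupM sE' E'v' (CE' _ Cc').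
  have Evc : E (v * c) := subgroupM sE (VE _ Vv) (CE _ Cc).
  (* Both v c and v' c' lie in f U, so this quotient is in [U]; it is in [E0] because [E] is
     contained in [E0]. *)
  exists ((v * c)^-1 * (v' * c')); last by rewrite mulVKg.
  split; last first.
    apply: EE0; apply: (subgroupM sE (subgroupV sE Evc)).
    by have [] := E'vc.
  have -> : (v * c)^-1 * (v' * c') =
      (f^-1 * (v * c))^-1 * (f^-1 * (v' * c')).
    by rewrite [(f^-1 * _)^-1]invgM invgK -(mulgA _ f) mulVKg.
  exact: (subgroupM sU (subgroupV sU Uf) Uf').
(* Quantifying over v lets the correction from [V] left by one letter be absorbed before the
   next. *)
have EV : E `<=` [set x | forall v, V v -> exists2 w, V w & E' (v * x * w)].
  apply: smallest_subgroup_ind.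
  - by move=> d [/CV|]; [left|right; exact: subgroupV].
  - move=> v Vv; exists v^-1; first exact: subgroupV.
    by rewrite mulg1 mulgV; exact: subgroup1.
  move=> d x [Cd|Vd] Px v Vv /=.
    have [u Vu E'u] := VCV _ _ Vv Cd.
    have [w Vw E'w] := Px _ (subgroupV sV Vu).
    exists w => //; have -> : v * (d * x) * w = (v * d * u) * (u^-1 * x * w).
      by rewrite !mulgA mulgK.
    exact: (subgroupM sE' E'u E'w).
  by rewrite mulgA; apply: Px; exact: subgroupM.
(* Taking v = 1 and the inverse of e turns E = E' V into E = V E', so the compact [V] meets every
   left coset of [E'] in [E]. *)
apply: (finite_index_compact cV VE oE') => e Ee.
have [w Vw E'w] := EV _ (subgroupV sE Ee) 1 (subgroup1 sV).
exists w => //; rewrite -[w^-1 * e]invgK; apply: (subgroupV sE').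
by move: E'w; rewrite mul1g invgM invgK.
Qed.

(** * Commensurability and uniqueness of envelopes *)

Lemma commensurateC A B : commensurate A B -> commensurate B A.
Proof. by rewrite /commensurate setIC => -[]. Qed.

Lemma commensurate_refl A : subgroup A -> commensurate A A.
Proof. by move=> sA; split; rewrite setIid; exact: finite_index_refl. Qed.

Lemma finite_index_setI_trans A B C : subgroup A -> subgroup B -> subgroup C ->
  finite_index A (A `&` B) -> finite_index B (B `&` C) ->
  finite_index A (A `&` C).
Proof.
move=> sA sB sC fAB fBC; have sAB := subgroupI sA sB.
apply: (@finite_indexSr _ (A `&` B `&` C)).
- exact: subgroupI.
- exact: subgroupI.
- by move=> x [[]].
apply: (@finite_index_trans _ _ (A `&` B)) => //; first exact: subgroupI.
exact: (@finite_index_setI _ B).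
Qed.

Lemma commensurate_trans A B C : subgroup A -> subgroup B -> subgroup C ->
  commensurate A B -> commensurate B C -> commensurate A C.
Proof.
move=> sA sB sC [AB]; rewrite setIC => BA [BC]; rewrite setIC => CB.
split; first exact: (@finite_index_setI_trans _ B).
by rewrite setIC; exact: (@finite_index_setI_trans _ B).
Qed.

Lemma commensurability_class_eq A B : subgroup A -> subgroup B ->
  commensurate A B -> commensurability_class A = commensurability_class B.
Proof.
move=> sA sB AB; apply/seteqP; split=> E [[sE oE] EA]; split=> //.
  exact: commensurate_trans AB.
by apply: (@commensurate_trans _ B) => //; exact: commensurateC.
Qed.

Lemma reduced_envelope_commensurate L E1 E2 : subgroup L ->
  reduced_envelope L E1 -> reduced_envelope L E2 -> commensurate E1 E2.
Proof.
move=> sL [oE1 LE1 min1] [oE2 LE2 min2].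
by split; [|rewrite setIC]; [apply: min1|apply: min2] => //;
  rewrite setIidl//; exact: finite_index_refl.
Qed.

Lemma envelope_class_reduced L R : subgroup L -> reduced_envelope L R ->
  envelope_class L = commensurability_class R.
Proof.
move=> sL LR; have [[sR oR] _ _] := LR.
apply/seteqP; split=> E [[sE oE]]; last by move=> ER; split=> //; exists R.
move=> [R' LR' ER']; split=> //; have [[sR' _] _ _] := LR'.
apply: (commensurate_trans _ _ _ ER') => //.
exact: reduced_envelope_commensurate LR' LR.
Qed.

End TopologicalGroup.

(** * Homomorphisms and envelopes of images *)

Section Homomorphism.
Variables (G H : topologicalGroupType) (phi : {multiplicative G -> H}).
Hypothesis phi_cont : continuous phi.
Implicit Types (A K O : set G) (B : set H).

Lemma multiplicative1 : phi 1 = 1.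
Proof. by apply: (mulgI (phi 1)); rewrite -gmulfM !mulg1. Qed.

Lemma multiplicativeV x : phi x^-1 = (phi x)^-1.
Proof. by apply: (mulgI (phi x)); rewrite -gmulfM !mulgV multiplicative1. Qed.

Lemma subgroup_image A : subgroup A -> subgroup (phi @` A).
Proof.
move=> sA; apply/subgroupP; split.
  by exists 1; [exact: subgroup1|exact: multiplicative1].
move=> _ _ [x Ax <-] [y Ay <-]; exists (x / y).
  by apply: subgroupM => //; exact: subgroupV.
by rewrite gmulfM multiplicativeV.
Qed.

Lemma subgroup_preimage B : subgroup B -> subgroup (phi @^-1` B).
Proof.
move=> sB; apply/subgroupP; split=> [|x y Bx By].
  by rewrite /= multiplicative1; exact: subgroup1.
rewrite /= gmulfM multiplicativeV.
exact: (subgroupM sB Bx (subgroupV sB By)).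
Qed.

Lemma open_subgroup_preimage B : open_subgroup B -> open_subgroup (phi @^-1` B).
Proof.
move=> [sB oB]; split; first exact: subgroup_preimage.
by apply: open_comp => // x _; exact: phi_cont.
Qed.

Lemma image_smallest_subgroup (C : set G) :
  phi @` smallest (@subgroup G) C = smallest (@subgroup H) (phi @` C).
Proof.
apply/seteqP; split; last first.
  apply: smallest_sub; first exact: subgroup_image (subgroup_smallest _).
  by apply: image_subset; exact: sub_gen_smallest.
apply/image_subP; apply: smallest_sub.
  exact: subgroup_preimage (subgroup_smallest _).
move=> x Cx; rewrite /preimage /=; apply: sub_gen_smallest.
by exists x.
Qed.

Lemma compactly_generated_image K : compactly_generated K ->
  compactly_generated (phi @` K).
Proof.
move=> [C cC ->]; exists (phi @` C); last exact: image_smallest_subgroup.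
apply: continuous_compact cC; apply: continuous_subspaceT.
exact: phi_cont.
Qed.

Lemma finite_index_image A B : subgroup A -> subgroup B ->
  finite_index A (A `&` phi @^-1` B) ->
  finite_index (phi @` A) (phi @` A `&` B).
Proof.
move=> sA sB; have sP := subgroup_preimage sB; have sI := subgroup_image sA.
move=> /(finite_indexP _ (subgroupI sA sP))[F [fF FA AF]].
apply/finite_indexP; first exact: subgroupI.
exists (phi @` F); split; first exact: finite_image.
  by move=> _ [f Ff <-]; exists f => //; exact: FA.
move=> _ [a Aa <-]; have [f Ff [Afa Bfa]] := AF _ Aa.
have phifa : phi (f^-1 * a) = (phi f)^-1 * phi a.
  by rewrite gmulfM multiplicativeV.
exists (phi f); first by exists f.
by rewrite -phifa; split=> //; exists (f^-1 * a).
Qed.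

Lemma reduced_envelope_image_sub (K1 K2 : set G) (F1 F2 : set H) :
  subgroup K1 -> subgroup K2 -> envelope_equivalent K1 K2 ->
  reduced_envelope (phi @` K1) F1 -> reduced_envelope (phi @` K2) F2 ->
  finite_index F2 (F2 `&` F1).
Proof.
move=> sK1 sK2 [[E1 KE1] _ eqE] [oF1 KF1 _] [_ _ minF2].
have [oE1 _ minE1] := KE1; have [sE1 _] := oE1; have [sF1 _] := oF1.
(* [E1] itself lies in the common class, which provides a reduced envelope [E2] of [K2] commensurate
   to it. *)
have : envelope_class K1 E1.
  by split=> //; exists E1 => //; exact: commensurate_refl.
rewrite eqE => -[_ [E2 [[sE2 _] KE2 _] [_ E21]]].
have oP := open_subgroup_preimage oF1; have [sP _] := oP.
have E1P : finite_index E1 (E1 `&` phi @^-1` F1).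
  apply: minE1 => //; rewrite setIidl; first exact: finite_index_refl.
  by move=> x Kx; apply: KF1; exists x.
apply: minF2 => //; apply: finite_index_image => //.
apply: (@finite_index_setI _ _ E2) => //.
by apply: (@finite_index_setI_trans _ _ E1) => //; rewrite setIC.
Qed.

End Homomorphism.

Lemma envelope_equivalent_sym (G : topologicalGroupType) (L1 L2 : set G) :
  envelope_equivalent L1 L2 -> envelope_equivalent L2 L1.
Proof. by move=> []. Qed.

Lemma envelope_equivalent_image (G H : topologicalGroupType)
    (phi : {multiplicative G -> H}) (K1 K2 : set G) :
  tdlc_group H -> continuous phi -> compactly_generated K1 ->
  compactly_generated K2 -> envelope_equivalent K1 K2 ->
  envelope_equivalent (phi @` K1) (phi @` K2).
Proof.
move=> tH cphi cK1 cK2 K12.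
have sK1 := compactly_generated_subgroup cK1.
have sK2 := compactly_generated_subgroup cK2.
have [F1 [KF1 _]] :=
  reduced_envelope_ex tH (compactly_generated_image cphi cK1).
have [F2 [KF2 _]] :=
  reduced_envelope_ex tH (compactly_generated_image cphi cK2).
split; [by exists F1|by exists F2|].
rewrite (envelope_class_reduced (subgroup_image phi sK1) KF1).
rewrite (envelope_class_reduced (subgroup_image phi sK2) KF2).
have [[sF1 _] _ _] := KF1; have [[sF2 _] _ _] := KF2.
apply: commensurability_class_eq => //; split; last rewrite setIC.
  apply: (reduced_envelope_image_sub cphi sK2 sK1 _ KF2 KF1).
  exact: envelope_equivalent_sym.
exact: (reduced_envelope_image_sub cphi sK1 sK2 K12 KF1 KF2).
Qed.

(** * Surjectivity for cocompact images *)

(* X is covered by finitely many cosets f O; those meeting M O have the form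
   m O with m in M, and translating by m^-1 moves the part of X in m O into O. *)
Lemma cocompact_open_subgroup (H : topologicalGroupType) (M X O : set H) :
  subgroup M -> compact X -> [set: H] = [set m * x | m in M & x in X] ->
  open_subgroup O ->
  exists Y, [/\ compact Y, Y `<=` O
    & forall o, O o -> exists2 y, Y y & M (y * o)].
Proof.
move=> sM cX HMX oO; have [sO _] := oO.
have [F [fF _ XF]] := compact_finite_cosets cX oO.
(* r f translates f into [O] whenever some element of [M] does; the default 1 keeps r f in [M]
   otherwise. *)
have /choice[r rP] (f : H) : exists m, M m /\
    ((exists2 m, M m & O (m^-1 * f)) -> O (m^-1 * f)).
  have [[m Mm Omf]|nm] := pselect (exists2 m, M m & O (m^-1 * f)).
    by exists m.
  by exists 1; split=> //; exact: subgroup1.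
pose Z := [set m^-1 * x | m in r @` F & x in X].
have cZ : compact (Z `&` O).
  apply: compact_closedI; last exact: open_subgroup_closed.
  have -> : Z = [set a * x | a in [set m^-1 | m in r @` F] & x in X].
    apply/seteqP; split=> [_ [m rFm [x Xx <-]]|_ [_ [m rFm <-] [x Xx <-]]].
      by exists m^-1; [exists m|exists x].
    by exists m => //; exists x.
  apply: compact_mulg => //; apply/finite_compact/finite_image.
  exact: finite_image.
exists (Z `&` O); split; [exact: cZ|by move=> z []|].
move=> o Oo.
(* Decomposing the inverse of o puts the compact factor to the left of o, as the conclusion
   requires. *)
have [m Mm [x Xx oE]] : [set m * x | m in M & x in X] o^-1 by rewrite -HMX.
have [f Ff Ofx] := XF _ Xx; have [Mr Or] := rP f.
have {}Or : O ((r f)^-1 * f).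
  apply: Or; exists m^-1; first exact: subgroupV.
  rewrite invgK; have -> : m * f = o^-1 * (f^-1 * x)^-1.
    by rewrite -oE invgM invgK mulgA mulgK.
  exact: (subgroupM sO (subgroupV sO Oo) (subgroupV sO Ofx)).
exists ((r f)^-1 * x).
  split; first by exists (r f); [exists f|exists x].
  have -> : (r f)^-1 * x = ((r f)^-1 * f) * (f^-1 * x) by rewrite -mulgA mulVKg.
  exact: (subgroupM sO).
rewrite -[o]invgK -oE invgM mulgA mulgK.
by apply: (subgroupM sM); exact: (subgroupV sM).
Qed.

(* Write O = Z (M ∩ O) with Z compact, let O be generated by the compact
   symmetric set D and let U ≤ O be a compact open subgroup.  By compactness
   D U Z ⊆ U Z F for some finite subset F of M ∩ O, so O = U Z <F>. *)
Lemma finitely_generated_envelope_ex (H : topologicalGroupType)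
    (M X O : set H) : tdlc_group H ->
  subgroup M -> compact X -> [set: H] = [set m * x | m in M & x in X] ->
  open_subgroup O -> compactly_generated O ->
  exists F, [/\ finite_set F, F `<=` M
    & reduced_envelope (smallest (@subgroup H) F) O].
Proof.
move=> tH sM cX HMX oO /compactly_generated_sym[D [cD DV OE]].
have [sO _] := oO.
have DO : D `<=` O by rewrite OE; exact: sub_gen_smallest.
have [U [oU cU UO]] := van_dantzig tH oO; have [sU _] := oU.
have [Y [cY YO YM]] := cocompact_open_subgroup sM cX HMX oO.
have [F0 [fF0 F0Y YUDF]] :=
  compact_finite_cosets (compact_mulg (compact_mulg cY cU) cD) oU.
have F0O : F0 `<=` O.
  move=> f /F0Y[_ [y Yy [u Uu <-]] [d Dd <-]].
  by apply: (subgroupM sO); [apply: (subgroupM sO)|]; auto.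
have /choice[y yP] (f : H) : exists y, F0 f -> Y y /\ M (y * f^-1).
  have [F0f|nF0f] := pselect (F0 f); last by exists 1.
  by have [y ? ?] := YM _ (subgroupV sO (F0O _ F0f)); exists y.
pose m f := y f * f^-1.
pose L := smallest (@subgroup H) (m @` F0).
have sL : subgroup L := subgroup_smallest _.
have LO : L `<=` O.
  apply: smallest_sub => // _ [f F0f <-]; have [Yy _] := yP _ F0f.
  by apply: (subgroupM sO (YO _ Yy)); apply: (subgroupV sO); exact: F0O.
exists (m @` F0); split; first exact: finite_image.
  by move=> _ [f /yP[] _ + <-].
have [y0 Yy0 _] := YM _ (subgroup1 sO).
(* The point [y0] makes the base case hold, with z = y0 and u = 1, since [Y] need not contain 1. *)
pose P x := exists2 z, Y z & exists2 u, U u & L (z * u * x * y0^-1).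
have OP : O `<=` P.
  rewrite OE; apply: smallest_subgroup_ind => //.
    exists y0 => //; exists 1; first exact: subgroup1.
    by rewrite !mulg1 mulgV; exact: subgroup1.
  move=> d x Dd [z Yz [u Uu Lx]].
  (* Writing z u d^-1 as f u' with u' in [U] and replacing z by y f multiplies the element of [L] on
     the left by the generator m f. *)
  have [|f F0f Uf] := YUDF (z * u * d^-1).
    exists (z * u); first by exists z => //; exists u.
    by exists d^-1 => //; exact: DV.
  have [Yyf _] := yP _ F0f; exists (y f) => //.
  exists (f^-1 * (z * u * d^-1)) => //.
  have -> : y f * (f^-1 * (z * u * d^-1)) * (d * x) * y0^-1 =
      m f * (z * u * x * y0^-1).
    by rewrite /m !mulgA mulgVK.
  by apply: (subgroupM sL) => //; apply: sub_gen_smallest; exists f.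
apply: reduced_envelope_min => // E2 oE2 LE2.
have oOE2 := open_subgroupI oO oE2.
apply: (finite_index_compact (compact_invg (compact_mulg cY cU)) _ oOE2).
  move=> _ [_ [z Yz [u Uu <-]] <-]; apply: (subgroupV sO).
  by apply: (subgroupM sO); auto.
(* Applying [OP] to x y0 cancels the base point: z u x is in [L], so the inverses of elements of Y U
   represent all left cosets. *)
move=> x Ox; have [z Yz [u Uu Lx]] := OP _ (subgroupM sO Ox (YO _ Yy0)).
rewrite !mulgA mulgK in Lx.
exists (z * u)^-1; first by exists (z * u) => //; exists z => //; exists u.
by rewrite invgK; split; [exact: LO|exact: LE2].
Qed.

(** [O] is generated by lifts of a finite set [F] and a compact open subgroup of the preimage of
    [B]; the latter makes [O] open while its image stays between the group generated by [F] and
    [B]. *)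
Lemma envelope_class_surj (G H : topologicalGroupType)
    (phi : {multiplicative G -> H}) (X B : set H) :
  tdlc_group G -> tdlc_group H -> continuous phi -> compact X ->
  [set: H] = [set g * x | g in range phi & x in X] ->
  open_subgroup B -> compactly_generated B ->
  exists O, [/\ open_subgroup O, compactly_generated O
    & envelope_class (phi @` O) = commensurability_class B].
Proof.
move=> tG tH cphi cX HX oB cB.
have sM : subgroup (range phi) by apply: subgroup_image; apply/subgroupP.
have [F [fF FM [_ LB minB]]] :=
  finitely_generated_envelope_ex tH sM cX HX oB cB.
have [sB _] := oB.
have oP := open_subgroup_preimage cphi oB; have [sP _] := oP.
have [V [oV cV VP]] := van_dantzig tG oP.
have /choice[g gP] (f : H) : exists x, F f -> phi x = f.
  by have [/FM[x _ xf]|nF] := pselect (F f); [exists x|exists 1].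
pose O := smallest (@subgroup G) (g @` F `|` V).
have sO : subgroup O := subgroup_smallest _.
have oO : open_subgroup O.
  by apply: (open_subgroupS oV sO); apply: sub_smallest; right.
have FB : F `<=` B by apply: subset_trans LB; exact: sub_gen_smallest.
have OB : phi @` O `<=` B.
  apply/image_subP; apply: smallest_sub => //; rewrite subUset; split=> //.
  by move=> _ [f Ff <-] /=; rewrite gP//; exact: FB.
have spO := subgroup_image phi sO.
have LO : smallest (@subgroup H) F `<=` phi @` O.
  apply: smallest_sub => // f Ff; exists (g f); last exact: gP.
  by apply: sub_gen_smallest; left; exists f.
exists O; split=> //.
  exists (g @` F `|` V) => //; apply: compactU => //.
  exact/finite_compact/finite_image.
apply: envelope_class_reduced => //; split=> // E2 oE2 fE2; apply: minB => //.
have [sE2 _] := oE2.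
by apply: (@finite_index_setI _ _ (phi @` O)) => //; exact: subgroup_smallest.
Qed.

Theorem theorem4 (G H : topologicalGroupType)
    (tdlcG : tdlc_group G) (tdlcH : tdlc_group H)
    (phi : {multiplicative G -> H}) (phi_cont : continuous phi) :
  (forall K1 K2 : set G,
     compactly_generated K1 -> compactly_generated K2 ->
     envelope_equivalent K1 K2 ->
     envelope_equivalent (phi @` K1) (phi @` K2)) /\
  (exists theta : {fun cg_open_classes G >-> cg_open_classes H},
     (forall O : set G, open_subgroup O -> compactly_generated O ->
        theta (envelope_class O) = envelope_class (phi @` O)) /\
     ((exists2 X : set H, compact X
         & [set: H] = [set g * x | g in range phi & x in X]) ->
      set_surj (cg_open_classes G) (cg_open_classes H) theta)).
Proof.
have envI O : open_subgroup O -> compactly_generated O ->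
    cg_open_classes H (envelope_class (phi @` O)).
  move=> oO cO; have cpO := compactly_generated_image phi_cont cO.
  have [E [OE cE]] := reduced_envelope_ex tdlcH cpO.
  exists E; first by have [oE _ _] := OE.
  by rewrite (envelope_class_reduced (compactly_generated_subgroup cpO) OE).
have phiE K1 K2 : compactly_generated K1 -> compactly_generated K2 ->
     envelope_equivalent K1 K2 -> envelope_equivalent (phi @` K1) (phi @` K2).
  by move=> cK1 cK2; exact: envelope_equivalent_image.
split=> //.
(* Open subgroups are their own envelopes, so equal classes mean envelope equivalence and [phiE]
   makes d independent of O; a set that is no such class is sent to the empty set. *)
have /choice[theta thetaP] (c : set (set G)) : exists d, forall O,
    open_subgroup O -> compactly_generated O -> envelope_class O = c ->
    d = envelope_class (phi @` O).
  have [[O [oO cO <-]]|nO] := pselect (exists O, [/\ open_subgroup O,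
      compactly_generated O & envelope_class O = c]); last first.
    by exists set0 => O oO cO OE; exfalso; apply: nO; exists O.
  exists (envelope_class (phi @` O)) => O' oO' cO' O'O.
  have [//|_ _ //] := phiE O O' cO cO'.
  by split=> //; [exists O|exists O']; exact: open_subgroup_reduced_envelope.
have thetaE O : open_subgroup O -> compactly_generated O ->
    theta (envelope_class O) = envelope_class (phi @` O).
  by move=> oO cO; exact: thetaP.
have theta_fun : set_fun (cg_open_classes G) (cg_open_classes H) theta.
  move=> _ [O [oO cO] <-]; rewrite -(envelope_class_open oO) thetaE //.
  exact: envI.
exists (mkfun_fun theta_fun); split=> // -[X cX HX] _ [B [oB cB] <-].
have [O [oO cO OB]] := envelope_class_surj tdlcG tdlcH phi_cont cX HX oB cB.
exists (envelope_class O); last by rewrite -OB -thetaE.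
by exists O => //; rewrite envelope_class_open.
Qed.
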